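(* Let $K$ be a matroid, and let $N$ be a matroid whose ground set is the set of hyperplanes of $K$, such that: if $\mathcal{H}'$ is a set of hyperplanes of $K$ for which no hyperplane in $\mathcal{H}'$ contains the intersection of the others, and $r_K(\bigcap_{H\in\mathcal{H}'}H)=r(K)-|\mathcal{H}'|$, then each hyperplane $H'$ of $K$ that contains $\bigcap_{H\in\mathcal{H}'}H$ satisfies $H'\in\mathrm{cl}_N(\mathcal{H}')$. Then the function $r_{K_N}$ defined, for all $X\subseteq E(K)$, by $$r_{K_N}(X)=r_K(X)-r(N)+r_N(\{H\colon H\text{ is a hyperplane of } K \text{ that contains } X\})$$ is the rank function of a matroid $K_N$ on $E(K)$ which is a rank-$r(N)$ projection of $K$.
   Context: Matroids are finite; $\mathrm{cl}_N$ is the closure operator of $N$. The intersection of an empty collection of hyperplanes of $K$ is understood to be $E(K)$. A matroid $M$ is a projection (or quotient) of a matroid $K$ if $K$ is a lift of $M$, i.e. there is a matroid $P$ and a subset $X$ of $E(P)$ so that $P\setminus X=K$ and $P/X=M$. It is a rank-$k$ projection of $K$ if moreover $r(K)-r(M)=k$. *)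

(* Defs.v *)
From mathcomp Require Import all_boot all_order all_algebra.
Set Implicit Arguments.
Unset Strict Implicit.
Unset Printing Implicit Defensive.

Section Matroid.
Variable T : finType.

(* Independence axioms; boolean, so that two matroids with the same ground set
   and the same independent sets are Leibniz equal. *)
Definition matroid_axioms (E : {set T}) (I : {set {set T}}) : bool :=
  [&& [forall A in I, A \subset E],
      set0 \in I,
      [forall A in I, forall B : {set T}, (B \subset A) ==> (B \in I)]
    & [forall A in I, forall B in I,
         (#|A| < #|B|) ==> [exists x in B :\: A, x |: A \in I]]].

(* The ground set is a subset of the carrier type, not the whole of it. *)
Record matroid := Matroid {
  ground : {set T};
  indep : {set {set T}};
  matroid_ok : matroid_axioms ground indep }.

Lemma matroid_axiomsP (E : {set T}) (I : {set {set T}}) :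
  reflect [/\ forall A : {set T}, A \in I -> A \subset E,
              set0 \in I,
              forall A B : {set T}, A \in I -> B \subset A -> B \in I
            & forall A B, A \in I -> B \in I -> #|A| < #|B| ->
                exists2 x, x \in B :\: A & x |: A \in I]
          (matroid_axioms E I).
Proof.
apply: (iffP and4P) => -[h1 h2 h3 h4]; split=> //.
- by move=> A; exact: (forall_inP h1).
- by move=> A B AI; have /forallP/(_ B)/implyP := forall_inP h3 _ AI.
- move=> A B AI BI lt_AB.
  have /implyP/(_ lt_AB)/exists_inP := forall_inP (forall_inP h4 _ AI) _ BI.
  by [].
- by apply/forall_inP.
- by apply/forall_inP => A AI; apply/forallP => B; apply/implyP; exact: h3.
- apply/forall_inP => A AI; apply/forall_inP => B BI; apply/implyP => lt_AB.
  by apply/exists_inP; exact: h4.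
Qed.

Implicit Types (M : matroid) (X : {set T}).

Definition rank M X : nat := \max_(A in indep M | A \subset X) #|A|.

Definition rk M : nat := rank M (ground M).

Definition cl M X : {set T} :=
  [set x in ground M | rank M (x |: X) == rank M X].

Definition flat M X : bool := cl M X == X.

Definition hyperplane M X : bool := flat M X && ((rank M X).+1 == rk M).

Definition hyperplanes M : {set {set T}} := [set H | hyperplane M H].

(* The intersection with [ground M] only matters when [Hs] is empty. *)
Definition meet M (Hs : {set {set T}}) : {set T} :=
  ground M :&: \bigcap_(H in Hs) H.

Definition deletion_indep M X : {set {set T}} :=
  [set A in indep M | A \subset ground M :\: X].

Definition basis_of M X (J : {set T}) : bool :=
  [&& J \in indep M, J \subset X & #|J| == rank M X].

Definition contraction_indep M X : {set {set T}} :=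
  [set A : {set T} | (A \subset ground M :\: X) &&
     [exists (J : {set T} | basis_of M X J), A :|: J \in indep M]].

Lemma deletion_ok M X : matroid_axioms (ground M :\: X) (deletion_indep M X).
Proof.
have /matroid_axiomsP[_ I0 IS IX] := matroid_ok M.
apply/matroid_axiomsP; split.
- by move=> A; rewrite inE => /andP[].
- by rewrite inE I0 sub0set.
- move=> A B; rewrite !inE => /andP[AI AE] BA.
  by rewrite (IS A) // (subset_trans BA).
- move=> A B; rewrite !inE => /andP[AI AE] /andP[BI BE] lt_AB.
  have [x xBA xAI] := IX _ _ AI BI lt_AB; exists x => //.
  rewrite inE xAI subUset AE andbT sub1set.
  by apply: (subsetP BE); move: xBA; rewrite inE => /andP[].
Qed.

Definition deletion M X : matroid := Matroid (deletion_ok M X).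

Lemma contraction_ok M X :
  matroid_axioms (ground M :\: X) (contraction_indep M X).
Proof.
have /matroid_axiomsP[_ I0 IS IX] := matroid_ok M.
have leq_rank A : A \in indep M -> A \subset X -> #|A| <= rank M X.
  by move=> AI AX; apply: (@leq_bigmax_cond _ _ (fun A : {set T} => #|A|));
    rewrite AI.
have disj (A J : {set T}) : A \subset ground M :\: X -> J \subset X ->
    #|A :|: J| = #|A| + #|J|.
  move=> AE JX; rewrite cardsU -[RHS]subn0; congr (_ - _).
  apply: eq_card0 => x; rewrite !inE; apply/negP => /andP[xA xJ].
  by have := subsetP AE _ xA; rewrite inE (subsetP JX _ xJ).
apply/matroid_axiomsP; split.
- by move=> A; rewrite inE => /andP[].
- rewrite inE sub0set /=; apply/exists_inP.
  have nonempty : 0 < #|[pred A in indep M | A \subset X]|.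
    by apply/card_gt0P; exists set0; rewrite inE I0 sub0set.
  have [J /andP[JI JX] rJ] :=
    @eq_bigmax_cond _ _ (fun A : {set T} => #|A|) nonempty.
  by exists J; rewrite ?set0U // /basis_of JI JX /rank rJ eqxx.
- move=> A B; rewrite !inE => /andP[AE /exists_inP[J bJ AJ]] BA.
  rewrite (subset_trans BA) //=; apply/exists_inP; exists J => //.
  by apply: IS AJ _; rewrite setSU.
- move=> A B; rewrite !inE => /andP[AE /exists_inP[J bJ AJ]].
  move=> /andP[BE /exists_inP[J' bJ' BJ']] lt_AB.
  have /and3P[JI JX /eqP rJ] := bJ; have /and3P[_ JX' /eqP rJ'] := bJ'.
  have [|x] := IX _ _ AJ BJ'; first by rewrite !disj // rJ rJ' ltn_add2r.
  rewrite !inE negb_or => /andP[/andP[xA xJ] xBJ'] xI.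
  have xX : x \notin X.
    apply/negP => xX; have: #|x |: J| <= rank M X.
      apply: leq_rank; last by rewrite subUset sub1set xX.
      by apply: IS xI _; rewrite setUS // subsetUr.
    by rewrite cardsU1 xJ rJ ltnn.
  have xB : x \in B.
    by case/orP: xBJ' => // xJ'; rewrite (subsetP JX' _ xJ') in xX.
  exists x; rewrite inE ?xA //.
  rewrite subUset AE sub1set (subsetP BE _ xB) /=; apply/exists_inP.
  by exists J => //; rewrite -setUA.
Qed.

Definition contraction M X : matroid := Matroid (contraction_ok M X).

End Matroid.

Lemma relabel_ok (T U : finType) (f : T -> U) (M : matroid T) :
  injective f ->
  matroid_axioms (f @: ground M) [set f @: A | A : {set T} in indep M].
Proof.
move=> f_inj; have /matroid_axiomsP[IE I0 IS IX] := matroid_ok M.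
apply/matroid_axiomsP; split.
- by move=> _ /imsetP[A AI ->]; rewrite imsetS // IE.
- by apply/imsetP; exists set0; rewrite ?imset0.
- move=> _ B /imsetP[A AI ->] BA; apply/imsetP; exists (f @^-1: B).
    apply: IS AI _; apply/subsetP => x; rewrite inE => /(subsetP BA).
    by rewrite (mem_imset _ _ f_inj).
  apply/setP => y; apply/idP/imsetP => [yB | [x]]; last by rewrite inE => ? ->.
  have /imsetP[x _ eyx] := subsetP BA _ yB.
  by exists x; rewrite // inE -eyx.
- move=> _ _ /imsetP[A AI ->] /imsetP[B BI ->]; rewrite !card_imset // => lt_AB.
  have [x xBA xAI] := IX _ _ AI BI lt_AB; exists (f x).
    by move: xBA; rewrite !inE !(mem_imset _ _ f_inj).
  by apply/imsetP; exists (x |: A); rewrite ?imsetU1.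
Qed.

Definition relabel (T U : finType) (f : T -> U) (f_inj : injective f)
    (M : matroid T) : matroid U :=
  Matroid (relabel_ok M f_inj).

(* The carrier [T] may have no room for the elements of [P] outside the ground
   set of [K], so [P] lives on some finite type into which [T] is embedded. *)
Definition projection (T : finType) (M K : matroid T) : Prop :=
  exists (U : finType) (f : T -> U) (f_inj : injective f)
         (P : matroid U) (X : {set U}),
    [/\ X \subset ground P,
        deletion P X = relabel f_inj K
      & contraction P X = relabel f_inj M].

Definition rank_projection (T : finType) (k : nat) (M K : matroid T) : Prop :=
  projection M K /\ ((rk K)%:Z - (rk M)%:Z = k%:Z)%R.

(* Main.v *)
Require Import Defs.
From mathcomp Require Import all_boot all_order all_algebra.
From mathcomp Require Import zify.
Set Implicit Arguments.
Unset Strict Implicit.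
Unset Printing Implicit Defensive.
(* The last import restores the [basis_of] of matroids, hidden by that of
   vector spaces. *)
Import GRing.Theory Defs.
Local Open Scope ring_scope.

(** Write h(X) for the set of hyperplanes of K that contain X, and put
    g(X) = r_K(X) + r_N(h(X)), so that the candidate rank function is
    g - r(N), which vanishes on the empty set because h(set0) is the ground
    set of N.

    The hypothesis on N enters in one way only.  Let B be a basis of K; for c
    in B call cl(B - c) a coordinate hyperplane.  Flats spanned by subsets of
    a common basis meet in the flat spanned by the intersection of the subsets
    ([cl_setD_basis]), so for C included in B the hyperplanes cl(B - c), c in
    C, form a set to which the hypothesis applies, and their intersection is
    cl(B - C).  Hence they span in N every hyperplane that contains B - C
    ([coordinate_hyperplanes_span]).

    Take X with a basis J, and J included in B, so that the cl(B - c) with c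
    in B - J span h(X).  If x is in B - J then all of these but cl(B - x)
    contain X + x, so r_N(h(X)) <= r_N(h(X + x)) + 1 and g is monotone
    ([rank_sum_setU1]).  If x and y are distinct members of B - J then each of
    them contains X + x or X + y, so h(X + x) and h(X + y) together span h(X),
    and submodularity of r_N gives the local submodularity of g
    ([rank_sum_submod]).  Points in the closure of X change neither r_K(X) nor
    h(X), so these two cases give the local rank axioms, which
    characterise matroids ([rank_matroid], [rank_matroidE]).

    Finally r_N(h(X)) decreases as X grows, so r_K - r_{K_N} is monotone.  Two
    matroids K and M on one ground set with r_K - r_M monotone are related by
    projection: add an independent set A of k = r(K) - r(M) new points, with
    rank min(r_K(X) + |A'|, r_M(X) + k) for X together with a subset A' of A
    ([quotient_projection]).  Deleting A gives K and contracting it gives M. *)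

(** * Matroids from local rank axioms *)

Lemma setU1_ind (T : finType) (E A : {set T}) (P : {set T} -> Prop) :
    P A ->
    (forall (C : {set T}) x, A \subset C -> C \subset E -> x \in E ->
       x \notin C -> P C -> P (x |: C)) ->
  forall B : {set T}, A \subset B -> B \subset E -> P B.
Proof.
move=> PA PU B; elim: {B}#|B :\: A|%N {-2}B (erefl #|B :\: A|%N) => [|n IH] B.
  move/eqP; rewrite cards_eq0 setD_eq0 => sBA sAB _.
  by have <- : A = B by apply/eqP; rewrite eqEsubset sAB.
move=> cBA sAB sBE; have [e|[x]] := set_0Vmem (B :\: A).
  by rewrite e cards0 in cBA.
rewrite inE => /andP[xA xB].
have sAC : A \subset B :\ x by rewrite subsetD1 sAB.
have sCE : B :\ x \subset E by rewrite (subset_trans _ sBE) ?subD1set.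
rewrite -(setD1K xB); apply: PU; rewrite ?setD11 ?(subsetP sBE) //.
apply: IH => //; rewrite setDDl setUC -setDDl.
by have := cardsD1 x (B :\: A); rewrite inE xA xB; lia.
Qed.

Section RankFunctions.
Local Open Scope nat_scope.
Variables (T : finType) (E : {set T}) (f : {set T} -> nat).
Implicit Types (A B C X Y : {set T}) (x y : T).

(** Local form of the axioms, in place of monotonicity and submodularity for
    all pairs of sets: a function defined through hyperplanes is easiest to
    control when only one or two points are added. *)
Definition rank_function : Prop :=
  [/\ f set0 = 0,
      forall A x, A \subset E -> x \in E -> f A <= f (x |: A) <= (f A).+1
    & forall A x y, A \subset E -> x \in E -> y \in E ->
        f (x |: A) = f A -> f (y |: A) = f A -> f (x |: (y |: A)) = f A].

Lemma submodular_rank_function :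
    f set0 = 0 ->
    (forall A B, A \subset B -> f A <= f B) ->
    (forall A x, f (x |: A) <= (f A).+1) ->
    (forall A B, f (A :|: B) + f (A :&: B) <= f A + f B) ->
  rank_function.
Proof.
move=> f0 fS f1 fM; split=> // [A x _ _ | A x y _ _ _ fx fy].
  by rewrite f1 fS // subsetUr.
have := fM (x |: A) (y |: A); rewrite -setUUl -setUIl -setUA fx fy.
have := fS A (x |: (y |: A)); have := fS A ([set x] :&: [set y] :|: A).
rewrite subsetUr setUA subsetUr; lia.
Qed.

Hypothesis f_rank : rank_function.

Lemma rank_function_mono A B :
  A \subset B -> B \subset E -> f A <= f B <= f A + #|B :\: A|.
Proof.
have [_ f1 _] := f_rank; move=> sAB.
apply: (setU1_ind (P := fun B => f A <= f B <= f A + #|B :\: A|) _ _ sAB).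
  by rewrite leqnn leq_addr.
move=> C x sAC sCE xE xC IH; have xA : x \notin A.
  by apply: contra xC; apply: (subsetP sAC).
rewrite setDUl (setDidPl _) ?disjoints1 // cardsU1 inE (negPf xC) andbF /=.
have := f1 _ _ sCE xE; lia.
Qed.

Lemma rank_function_card A : A \subset E -> f A <= #|A|.
Proof.
have [f0 _ _] := f_rank.
by move/(rank_function_mono (sub0set A)); rewrite f0 setD0; lia.
Qed.

(** The third axiom glues two points that do not raise the rank; induction on
    the size of [B] glues all of them. *)
Lemma rank_function_span A B :
    A \subset E -> B \subset E -> (forall x, x \in B -> f (x |: A) = f A) ->
  f (B :|: A) = f A.
Proof.
move=> sAE; have [_ _ f2] := f_rank.
elim: {B}_.+1 {-2}B (ltnSn #|B|) => // n IH B ltBn sBE fB.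
have [->|[x xB]] := set_0Vmem B; first by rewrite set0U.
have [B0|[y]] := set_0Vmem (B :\ x); first by rewrite -(setD1K xB) B0 setU0 fB.
rewrite !inE => /andP[yx yB].
have sub C : C \proper B -> f (C :|: A) = f A.
  move=> prCB; apply: IH; first by have := proper_card prCB; lia.
    exact: subset_trans (proper_sub prCB) sBE.
  by move=> z zC; apply/fB/(subsetP (proper_sub prCB)).
set C := B :\ x :\ y.
have Bx : B :\ x = y |: C by rewrite setD1K // !inE yx.
have By : B :\ y = x |: C.
  have ->: C = B :\ y :\ x by rewrite /C !setDDl setUC.
  by rewrite setD1K // !inE eq_sym yx.
have ->: B = x |: (y |: C) by rewrite -Bx setD1K.
have fC : f (C :|: A) = f A.
  by apply: sub; apply: sub_proper_trans (properD1 xB); apply: subD1set.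
rewrite -!setUA f2 ?fC ?(subsetP sBE) ?setUA -?By -?Bx ?sub ?properD1 //.
rewrite subUset sAE andbT (subset_trans _ sBE) //.
by rewrite /C !subDset !setUA subsetUr.
Qed.

Definition rank_indep : {set {set T}} :=
  [set A : {set T} | (A \subset E) && (f A == #|A|)].

Lemma rank_indep_extend A x :
    A \in rank_indep -> x \in E -> x \notin A -> x |: A \notin rank_indep ->
  f (x |: A) = f A.
Proof.
have [_ f1 _] := f_rank.
rewrite !inE => /andP[sAE /eqP fA] xE xA.
rewrite subUset sub1set xE sAE cardsU1 xA /=.
have := f1 _ _ sAE xE; lia.
Qed.

(** Augmentation is the contrapositive of [rank_function_span]: if no point of
    [B] extends [A], then [B :|: A] has the rank of [A], too small to contain
    an independent set larger than [A]. *)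
Lemma rank_indep_ok : matroid_axioms E rank_indep.
Proof.
apply/matroid_axiomsP; split.
- by move=> A; rewrite inE => /andP[].
- by have [f0 _ _] := f_rank; rewrite inE sub0set f0 cards0 eqxx.
- move=> A B; rewrite !inE => /andP[sAE /eqP fA] sBA.
  have sBE := subset_trans sBA sAE; rewrite sBE /=.
  have := rank_function_mono sBA sAE; have := rank_function_card sBE.
  by rewrite fA cardsDS //; have := subset_leq_card sBA; lia.
- move=> A B AI BI ltAB; apply/exists_inP.
  have := AI; have := BI; rewrite !inE.
  move=> /andP[sBE /eqP fB] /andP[sAE /eqP fA].
  apply: contraT => /exists_inPn noext.
  have fBA : f (B :|: A) = f A.
    apply: rank_function_span => // x xB.
    have [xA|xA] := boolP (x \in A); first by rewrite (setUidPr _) ?sub1set.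
    apply: rank_indep_extend; rewrite ?(subsetP sBE) //.
    by apply: noext; rewrite inE xA.
  have := @rank_function_mono B (B :|: A).
  by rewrite subsetUl subUset sBE sAE fBA; lia.
Qed.

Definition rank_matroid : matroid T := Matroid rank_indep_ok.

End RankFunctions.

(** * Rank and closure in a matroid *)

Section MatroidRank.
Local Open Scope nat_scope.
Variables (T : finType) (M : matroid T).
Implicit Types (A B C I J X Y S : {set T}) (x y : T).

Lemma indep_ground I : I \in indep M -> I \subset ground M.
Proof. by have /matroid_axiomsP[h _ _ _] := matroid_ok M; apply: h. Qed.

Lemma indep0 : set0 \in indep M.
Proof. by have /matroid_axiomsP[] := matroid_ok M. Qed.

Lemma indepS I J : J \subset I -> I \in indep M -> J \in indep M.
Proof. by have /matroid_axiomsP[_ _ h _] := matroid_ok M => ? /h; apply. Qed.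

Lemma indep_augment I J : I \in indep M -> J \in indep M -> #|I| < #|J| ->
  exists2 x, x \in J :\: I & x |: I \in indep M.
Proof. by have /matroid_axiomsP[_ _ _ h] := matroid_ok M; apply: h. Qed.

Lemma indep_le_rank I X : I \in indep M -> I \subset X -> #|I| <= rank M X.
Proof.
move=> iI sIX.
by apply: (@leq_bigmax_cond _ _ (fun A : {set T} => #|A|)); rewrite iI.
Qed.

Lemma basisP X J :
  reflect [/\ J \in indep M, J \subset X & #|J| = rank M X] (basis_of M X J).
Proof. by apply: (iffP and3P) => -[? ? /eqP]; split=> //; apply/eqP. Qed.

Lemma basis_exists X : exists J, basis_of M X J.
Proof.
have ne : 0 < #|[pred A in indep M | A \subset X]|.
  by apply/card_gt0P; exists set0; rewrite inE indep0 sub0set.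
have [J /andP[iJ sJX] rJ] :=
  @eq_bigmax_cond _ _ (fun A : {set T} => #|A|) ne.
by exists J; apply/basisP; rewrite /rank rJ.
Qed.

Lemma basis_extend I X : I \in indep M -> I \subset X ->
  exists2 J, basis_of M X J & I \subset J.
Proof.
elim: {I}_.+1 {-2}I (ltnSn (rank M X - #|I|)) => // n IH I ltn iI sIX.
have [leXI|ltIX] := leqP (rank M X) #|I|.
  exists I => //; apply/basisP; split=> //.
  by have := indep_le_rank iI sIX; lia.
have [J /basisP[iJ sJX rJ]] := basis_exists X.
have [|x] := indep_augment iI iJ; first by rewrite rJ.
rewrite inE => /andP[xI xJ] ixI.
have [| |K bK sxIK] := IH (x |: I) _ ixI; first by rewrite cardsU1 xI; lia.
  by rewrite subUset sIX sub1set (subsetP sJX).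
by exists K => //; apply: subset_trans sxIK; apply: subsetUr.
Qed.

Lemma rankS X Y : X \subset Y -> rank M X <= rank M Y.
Proof.
move=> sXY; have [J /basisP[iJ sJX <-]] := basis_exists X.
by apply: indep_le_rank => //; apply: subset_trans sXY.
Qed.

Lemma rank_indepE I : I \in indep M -> rank M I = #|I|.
Proof.
move=> iI; have [J /basisP[_ sJI rJ]] := basis_exists I.
by have := indep_le_rank iI (subxx I); have := subset_leq_card sJI; lia.
Qed.

Lemma card_rank_indep I : #|I| <= rank M I -> I \in indep M.
Proof.
have [J /basisP[iJ sJI <-]] := basis_exists I => leIJ.
by have /eqP <- : J == I by rewrite eqEcard sJI.
Qed.

Lemma rankIground X : rank M (X :&: ground M) = rank M X.
Proof.
apply/eqP; rewrite eqn_leq rankS ?subsetIl //=.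
have [J /basisP[iJ sJX <-]] := basis_exists X.
by rewrite indep_le_rank // subsetI sJX indep_ground.
Qed.

(** Extend a basis [I] of [X :&: Y] to a basis [B] of [X :|: Y], and count [B]
    in [X] and in [Y]. *)
Lemma rank_submod X Y :
  rank M (X :|: Y) + rank M (X :&: Y) <= rank M X + rank M Y.
Proof.
have [I /basisP[iI sI <-]] := basis_exists (X :&: Y).
have sIU : I \subset X :|: Y.
  by rewrite (subset_trans sI) // subIset // subsetUl.
have [B /basisP[iB sB <-] sIB] := basis_extend iI sIU.
have leX := indep_le_rank (indepS (subsetIl B X) iB) (subsetIr B X).
have leY := indep_le_rank (indepS (subsetIl B Y) iB) (subsetIr B Y).
have := cardsUI (B :&: X) (B :&: Y); rewrite -setIUr -setIIr (setIidPl sB).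
have : #|I| <= #|B :&: (X :&: Y)| by rewrite subset_leq_card // subsetI sIB.
lia.
Qed.

Lemma rank_le_card X : rank M X <= #|X|.
Proof.
by have [J /basisP[_ sJX <-]] := basis_exists X; apply: subset_leq_card.
Qed.

Lemma rankU1 X x : rank M (x |: X) <= (rank M X).+1.
Proof.
have := rank_submod [set x] X; have := rank_le_card [set x].
rewrite cards1; lia.
Qed.

Lemma rank_set0 : rank M set0 = 0.
Proof. by have := rank_le_card set0; rewrite cards0; lia. Qed.

Lemma rank_rank_function : rank_function (ground M) (rank M).
Proof.
apply: submodular_rank_function;
  [exact: rank_set0 | exact: rankS | | exact: rank_submod].
by move=> A x; apply: rankU1.
Qed.

Lemma rankU_basis X J S :
  J \subset X -> rank M J = rank M X -> rank M (S :|: J) = rank M (S :|: X).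
Proof.
move=> sJX rJ; apply/eqP; rewrite eqn_leq rankS ?setUS //=.
have := rank_submod (S :|: J) X; rewrite -setUA (setUidPr sJX).
have := @rankS J ((S :|: J) :&: X); rewrite subsetI subsetUr sJX => /(_ isT).
lia.
Qed.

Lemma clP X x :
  reflect (x \in ground M /\ rank M (x |: X) = rank M X) (x \in cl M X).
Proof. by rewrite inE; apply: (iffP andP) => -[-> /eqP]. Qed.

Lemma cl_ground X : cl M X \subset ground M.
Proof. by apply/subsetP => x /clP[]. Qed.

Lemma sub_cl X : X \subset ground M -> X \subset cl M X.
Proof.
move=> sXE; apply/subsetP => x xX; apply/clP.
by rewrite (subsetP sXE) // (setUidPr _) ?sub1set.
Qed.

Lemma clS X Y : X \subset Y -> cl M X \subset cl M Y.
Proof.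
move=> sXY; apply/subsetP => x /clP[xE rx]; apply/clP; split=> //.
have := rank_submod (x |: X) Y; rewrite -setUA (setUidPr sXY).
have := @rankS X ((x |: X) :&: Y); rewrite subsetI subsetUr sXY => /(_ isT).
by have := rankS (subsetUr [set x] Y); lia.
Qed.

Lemma rankU_cl X : X \subset ground M -> rank M (cl M X :|: X) = rank M X.
Proof.
move=> sXE; apply: (rank_function_span rank_rank_function) => //.
  exact: cl_ground.
by move=> x /clP[].
Qed.

Lemma rank_cl X : X \subset ground M -> rank M (cl M X) = rank M X.
Proof. by move=> sXE; rewrite -[RHS]rankU_cl // (setUidPl (sub_cl sXE)). Qed.

Lemma rank_sub_cl X Y :
  X \subset ground M -> Y \subset cl M X -> rank M Y <= rank M X.
Proof. by move=> sXE sYX; rewrite -(rank_cl sXE) rankS. Qed.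

Lemma flat_cl X : X \subset ground M -> flat M (cl M X).
Proof.
move=> sXE; rewrite /flat eqEsubset sub_cl ?cl_ground // andbT.
apply/subsetP => x /clP[xE rx]; apply/clP; split=> //.
have := rankS (setUS [set x] (sub_cl sXE)); rewrite rx rank_cl //.
by have := rankS (subsetUr [set x] X); lia.
Qed.

Lemma cl_sub_flat X Y : flat M Y -> X \subset Y -> cl M X \subset Y.
Proof. by move=> /eqP fY /clS; rewrite fY. Qed.

Lemma rank_notin_cl X x :
  x \in ground M -> x \notin cl M X -> rank M (x |: X) = (rank M X).+1.
Proof.
move=> xE; rewrite inE xE /=; have := rankU1 X x.
by have := rankS (subsetUr [set x] X); lia.
Qed.

Lemma basis_sub_cl X J : X \subset ground M -> basis_of M X J ->
  X \subset cl M J.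
Proof.
move=> sXE /basisP[iJ sJX rJ]; apply/subsetP => x xX; apply/clP.
rewrite (subsetP sXE) // (@rankU_basis X) ?(rank_indepE iJ) //; split=> //.
by rewrite (setUidPr _) ?sub1set.
Qed.

Lemma basis_setU1 X J x :
    X \subset ground M -> basis_of M X J -> x \in ground M -> x \notin cl M X ->
  basis_of M (x |: X) (x |: J).
Proof.
move=> sXE bJ xE xX; have /basisP[iJ sJX rJ] := bJ.
have xJ : x \notin J.
  by apply: contra xX => /(subsetP sJX)/(subsetP (sub_cl sXE)).
have r : rank M (x |: J) = rank M (x |: X).
  by apply: rankU_basis; rewrite ?(rank_indepE iJ).
have c : #|x |: J| = rank M (x |: X) by rewrite cardsU1 xJ rJ rank_notin_cl.
by apply/basisP; split; rewrite ?setUS //; apply: card_rank_indep; rewrite r c.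
Qed.

(** Submodularity for [x |: A] and [x |: B], whose union has rank at least
    [#|A :|: B|], leaves at most [#|A :&: B|] for [x |: A :&: B]. *)
Lemma clI_indep A B x : A :|: B \in indep M ->
  x \in cl M A -> x \in cl M B -> x \in cl M (A :&: B).
Proof.
move=> iU /clP[xE rA] /clP[_ rB]; apply/clP; split=> //.
have iA := indepS (subsetUl A B) iU; have iB := indepS (subsetUr A B) iU.
have iI := indepS (subsetIl A B) iA.
have := rank_submod (x |: A) (x |: B).
rewrite -setUUr -setUIr rA rB.
have := rankS (subsetUr [set x] (A :|: B)).
have := rankS (subsetUr [set x] (A :&: B)).
rewrite (rank_indepE iU) (rank_indepE iI) (rank_indepE iA) (rank_indepE iB).
have := cardsUI A B; lia.
Qed.

(** A point lies in the span of the basis elements that it really uses; it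
    can do without each element of [C], hence without all of [C]. *)
Lemma cl_setD_basis B C x : basis_of M (ground M) B -> C \subset B ->
    x \in ground M -> (forall c, c \in C -> x \in cl M (B :\ c)) ->
  x \in cl M (B :\: C).
Proof.
move=> bB; have /basisP[iB _ _] := bB.
elim: {C}#|C| {-2}C (erefl #|C|) => [|n IH] C.
  move/eqP; rewrite cards_eq0 => /eqP-> _ xE _; rewrite setD0.
  exact: subsetP (basis_sub_cl (subxx _) bB) _ xE.
move=> cC sCB xE clC.
have [C0|[c cCin]] := set_0Vmem C; first by rewrite C0 cards0 in cC.
have -> : B :\: C = (B :\: (C :\ c)) :&: (B :\ c).
  by rewrite -setDUr setUC setD1K.
apply: clI_indep (clC _ cCin).
  by rewrite (indepS _ iB) // subUset !subsetDl.
apply: IH => //; first by have := cardsD1 c C; rewrite cCin; lia.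
  by rewrite (subset_trans (subD1set _ _)).
by move=> d; rewrite inE => /andP[_]; apply: clC.
Qed.

End MatroidRank.

(** A largest independent subset of [X] cannot be extended inside [X], so it
    has the same value of [f] as [X] by [rank_function_span]. *)
Lemma rank_matroidE (T : finType) (E : {set T}) (f : {set T} -> nat)
    (f_rank : rank_function E f) (X : {set T}) :
  X \subset E -> rank (rank_matroid f_rank) X = f X.
Proof.
move=> sXE; set M := rank_matroid f_rank.
have [A /basisP[iA sAX rA]] := basis_exists M X.
have := iA; rewrite {1}inE => /andP[sAE /eqP fA].
rewrite -rA -fA -(setUidPl sAX); symmetry.
apply: (rank_function_span f_rank) => // x xX.
have [xA|xA] := boolP (x \in A); first by rewrite (setUidPr _) ?sub1set.
apply: (rank_indep_extend f_rank iA) => //; first exact: subsetP xX.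
apply/negP => ixA; have := @indep_le_rank _ M (x |: A) X ixA.
by rewrite subUset sAX sub1set xX cardsU1 xA -rA ltnn => /(_ isT).
Qed.

(** * Quotients are projections *)

Lemma subset_imset_ex (aT rT : finType) (f : aT -> rT) (D : {set aT})
    (Z : {set rT}) :
  Z \subset f @: D -> exists2 A : {set aT}, A \subset D & Z = f @: A.
Proof.
move=> sZ; exists (D :&: f @^-1: Z); first exact: subsetIl.
apply/setP => z; apply/idP/imsetP => [zZ | [x]].
  have /imsetP[x xD ez] := subsetP sZ _ zZ.
  by exists x; rewrite // !inE xD -ez.
by rewrite !inE => /andP[_ fx] ->.
Qed.

Lemma matroid_eq (T : finType) (M M' : matroid T) :
  ground M = ground M' -> indep M = indep M' -> M = M'.
Proof.
case: M M' => [E I p] [E' I' p'] /= eE eI; subst.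
by rewrite (bool_irrelevance p p').
Qed.

Section Quotient.
Local Open Scope nat_scope.
Variables (T : finType) (K M : matroid T).
Hypothesis groundE : ground M = ground K.
Hypothesis quotient : forall X Y : {set T}, X \subset Y -> Y \subset ground K ->
  rank M Y + rank K X <= rank K Y + rank M X.

Let k : nat := rk K - rk M.
Let U : finType := (T + 'I_k)%type.
Let E : {set U} := (inl @: ground K) :|: (inr @: [set: 'I_k]).
Let inT (Z : {set U}) : {set T} := inl @^-1: Z.
Let inA (Z : {set U}) : {set 'I_k} := inr @^-1: Z.

Lemma quotient_all (X Y : {set T}) : X \subset Y ->
  rank M Y + rank K X <= rank K Y + rank M X.
Proof.
move=> sXY; rewrite -(rankIground M X) -(rankIground M Y) groundE.
rewrite -(rankIground K X) -(rankIground K Y).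
by rewrite quotient ?setSI ?subsetIr.
Qed.

(** Rank of the extension of [K] by [k] points placed as freely as possible
    subject to their contraction giving [M]; contracting only [j] of them gives
    the Higgs lift of [M] with rank min(r_K, r_M + k - j). *)
Definition extension_rank (Z : {set U}) : nat :=
  minn (rank K (inT Z) + #|inA Z|) (rank M (inT Z) + k).

(** Submodularity is clear when both minima are attained on the same side.  If
    one is attained on the side of K, over X, and the other on the side of M,
    over Y, then r_K(X) - r_K(X :&: Y) >= r_M(X) - r_M(X :&: Y) because M is a
    quotient, and submodularity of r_M bounds the right side below by
    r_M(X :|: Y) - r_M(Y). *)
Lemma extension_rank_function : rank_function E extension_rank.
Proof.
apply: submodular_rank_function.
- by rewrite /extension_rank /inT /inA !preimset0 !rank_set0 cards0 min0n.
- move=> A B sAB; have sT : inT A \subset inT B by apply: preimsetS.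
  have sA : #|inA A| <= #|inA B| by rewrite subset_leq_card // preimsetS.
  have := rankS K sT; have := rankS M sT; rewrite /extension_rank; lia.
- move=> A [t|i]; rewrite /extension_rank.
    have ->: inT (inl t |: A) = t |: inT A by apply/setP => x; rewrite !inE.
    have ->: inA (inl t |: A) = inA A by apply/setP => x; rewrite !inE.
    have := rankU1 K (inT A) t; have := rankU1 M (inT A) t; lia.
  have ->: inT (inr i |: A) = inT A by apply/setP => x; rewrite !inE.
  have ->: inA (inr i |: A) = i |: inA A by apply/setP => x; rewrite !inE.
  rewrite cardsU1; lia.
- move=> A B; rewrite /extension_rank.
  have -> : inT (A :|: B) = inT A :|: inT B by apply: preimsetU.
  have -> : inT (A :&: B) = inT A :&: inT B by apply: preimsetI.
  have -> : inA (A :|: B) = inA A :|: inA B by apply: preimsetU.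
  have -> : inA (A :&: B) = inA A :&: inA B by apply: preimsetI.
  have := cardsUI (inA A) (inA B).
  have := subset_leq_card (subsetIl (inA A) (inA B)).
  have := subset_leq_card (subsetIr (inA A) (inA B)).
  have := rank_submod K (inT A) (inT B); have := rank_submod M (inT A) (inT B).
  have := quotient_all (subsetIl (inT A) (inT B)).
  have := quotient_all (subsetIr (inT A) (inT B)).
  have := rankS K (subsetUl (inT A) (inT B)).
  have := rankS K (subsetUr (inT A) (inT B)).
  lia.
Qed.

(** Without new points the minimum is r_K(A), as r_K(A) - r_M(A) is at most its
    value [k] on the ground set; with all [k] of them it is r_M(A) + k, as
    r_M <= r_K.  These are the ranks that deletion and contraction need. *)
Lemma quotient_projection : projection M K.
Proof.
pose P := rank_matroid extension_rank_function.
pose X : {set U} := inr @: [set: 'I_k].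
have inl_inj : injective (inl : T -> U) by move=> ? ? [].
have inr_inj : injective (inr : 'I_k -> U) by move=> ? ? [].
have cardX : #|X| = k by rewrite card_imset // cardsT card_ord.
have sXE : X \subset E by rewrite subsetUr.
have inl_X t : (inl t : U) \in X = false by apply/imsetP => -[].
have inr_X i : (inr i : U) \in X by rewrite imset_f ?inE.
have inr_T (A : {set T}) i : (inr i : U) \in inl @: A = false.
  by apply/imsetP => -[].
have groundD : E :\: X = inl @: ground K.
  by apply/setP => -[t|i]; rewrite in_setD in_setU ?inl_X ?orbF ?inr_X ?inr_T.
have rankA (A : {set T}) : A \subset ground K ->
    rank P (inl @: A) = rank K A /\ rank P (inl @: A :|: X) = rank M A + k.
  move=> sAE; have sAE' : inl @: A \subset E.
    by rewrite subsetU // imsetS.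
  rewrite !rank_matroidE ?subUset ?sAE' ?sXE // /extension_rank.
  have -> : inT (inl @: A) = A.
    by apply/setP => t; rewrite inE mem_imset.
  have -> : inT (inl @: A :|: X) = A.
    by apply/setP => t; rewrite !inE mem_imset // inl_X orbF.
  have -> : inA (inl @: A) = set0.
    by apply/setP => i; rewrite !inE inr_T.
  have -> : inA (inl @: A :|: X) = setT.
    by apply/setP => i; rewrite !inE inr_X orbT.
  rewrite cards0 cardsT card_ord.
  have := quotient_all sAE; have := quotient_all (sub0set A).
  by rewrite !rank_set0 /k /rk groundE; lia.
exists U, inl, inl_inj, P, X; split=> //.
- apply: matroid_eq => //=; apply/setP => Z; apply/idP/imsetP.
    rewrite inE => /andP[iZ]; rewrite groundD => /subset_imset_ex[A sAE eZ].
    exists A => //; apply: card_rank_indep.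
    by rewrite -(rankA _ sAE).1 -eZ rank_indepE // eZ card_imset.
  case=> A iA ->; have sAE := indep_ground iA.
  rewrite inE /= groundD imsetS // andbT; apply: (@card_rank_indep _ P).
  by rewrite (rankA _ sAE).1 card_imset // rank_indepE.
- have rankX : rank P X = k.
    by have [_] := rankA _ (sub0set _); rewrite imset0 set0U rank_set0.
  (* The new points are independent, so [X] is its own only basis. *)
  have iX : X \in indep P by apply: card_rank_indep; rewrite rankX cardX.
  have basisX J : basis_of P X J = (J == X).
    apply/basisP/eqP => [[iJ sJX rJ] | ->]; last by rewrite rankX.
    by apply/eqP; rewrite eqEcard sJX rJ rankX cardX /=.
  apply: matroid_eq => //=; first by rewrite groundD groundE.
  have cardU (A : {set T}) : #|inl @: A :|: X| = #|A| + k.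
    rewrite cardsU cardX card_imset // (_ : _ :&: _ = set0) ?cards0 ?subn0 //.
    by apply/setP => -[t|i]; rewrite in_setI in_set0 ?inl_X ?inr_T ?andbF.
  apply/setP => Z; apply/idP/imsetP.
    rewrite inE /= groundD => /andP[/subset_imset_ex[A sAE eZ]].
    move=> /exists_inP[J]; rewrite basisX => /eqP-> iZX.
    exists A => //; apply: card_rank_indep.
    rewrite -(leq_add2r k) -(rankA _ sAE).2 -eZ rank_indepE // eZ cardU //.
  case=> A iA ->; have sAE := indep_ground iA; rewrite groundE in sAE.
  rewrite inE /= groundD imsetS //=; apply/exists_inP.
  exists X; first by rewrite basisX.
  apply: (@card_rank_indep _ P).
  by rewrite cardU (rankA _ sAE).2 leq_add2r rank_indepE.
Qed.

End Quotient.

(** * The matroid on the hyperplanes *)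

Section HyperplaneMatroid.
Local Open Scope nat_scope.
Variables (T : finType) (K : matroid T) (N : matroid {set T}).
Implicit Types (A B C J X Y S : {set T}) (Hs Z : {set {set T}}) (x y : T).

Definition hyperplanes_over X : {set {set T}} :=
  [set H in hyperplanes K | X \subset H].

Lemma hyperplanes_overS X Y :
  X \subset Y -> hyperplanes_over Y \subset hyperplanes_over X.
Proof.
move=> sXY; apply/subsetP => H; rewrite !inE => /andP[-> sYH].
exact: subset_trans sYH.
Qed.

Lemma hyperplaneP H :
  reflect (flat K H /\ (rank K H).+1 = rk K) (H \in hyperplanes K).
Proof. by rewrite inE; apply: (iffP andP) => -[? /eqP]. Qed.

(** With the same fact for [rank K], this reduces every statement about
    [rank_sum] to points outside the closure. *)
Lemma hyperplanes_over_cl x X :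
  x \in cl K X -> hyperplanes_over (x |: X) = hyperplanes_over X.
Proof.
move=> xX; apply/eqP; rewrite eqEsubset hyperplanes_overS ?subsetUr //=.
apply/subsetP => H; rewrite !inE => /andP[/[dup] hH /andP[fH _] sXH].
by rewrite hH subUset sXH sub1set (subsetP (cl_sub_flat fH sXH)).
Qed.

Section CoordinateHyperplanes.
Variable B : {set T}.
Hypothesis basisB : basis_of K (ground K) B.

Lemma notin_cl_basis c : c \in B -> c \notin cl K (B :\ c).
Proof.
have /basisP[iB sBE rB] := basisB.
move=> cB; apply/negP => /clP[_]; rewrite setD1K //.
rewrite (rank_indepE iB) (rank_indepE (indepS (subD1set B c) iB)).
by have := cardsD1 c B; rewrite cB; lia.
Qed.

Lemma coordinate_hyperplane c : c \in B -> cl K (B :\ c) \in hyperplanes K.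
Proof.
have /basisP[iB sBE rB] := basisB.
move=> cB; have sE : B :\ c \subset ground K.
  by rewrite (subset_trans _ sBE) ?subD1set.
apply/hyperplaneP; rewrite flat_cl ?rank_cl //; split=> //.
rewrite (rank_indepE (indepS (subD1set B c) iB)) /rk -rB.
by have := cardsD1 c B; rewrite cB; lia.
Qed.

Lemma sub_coordinate_hyperplane c X J :
    X \subset ground K -> basis_of K X J -> J \subset B -> c \notin J ->
  X \subset cl K (B :\ c).
Proof.
move=> sXE bJ sJB cJ; apply: subset_trans (basis_sub_cl sXE bJ) _.
by apply: clS; rewrite subsetD1 sJB.
Qed.

Lemma meet_coordinate_hyperplanes C : C \subset B ->
  meet K [set cl K (B :\ c) | c in C] = cl K (B :\: C).
Proof.
move=> sCB; apply/eqP; rewrite eqEsubset; apply/andP; split.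
  apply/subsetP => x; rewrite inE => /andP[xE /bigcapP xC].
  apply: cl_setD_basis => // c cC; apply: xC; exact: imset_f.
rewrite subsetI cl_ground; apply/bigcapsP => _ /imsetP[c cC ->].
by apply: clS; rewrite setDS // sub1set.
Qed.

End CoordinateHyperplanes.

Hypothesis groundN : ground N = hyperplanes K.
Hypothesis closedN : forall Hs, Hs \subset hyperplanes K ->
  (forall H, H \in Hs -> ~~ (meet K (Hs :\ H) \subset H)) ->
  rank K (meet K Hs) + #|Hs| = rk K ->
  forall H, H \in hyperplanes K -> meet K Hs \subset H -> H \in cl N Hs.

(** The hypothesis on [N] applies to these hyperplanes: [cl K (B :\ c)] omits
    [c], which all the others contain, and the meet [cl K (B :\: C)] has the
    required rank. *)
Lemma coordinate_hyperplanes_span B C H :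
    basis_of K (ground K) B -> C \subset B ->
    H \in hyperplanes K -> B :\: C \subset H ->
  H \in cl N [set cl K (B :\ c) | c in C].
Proof.
move=> bB sCB hH sH; have /basisP[iB sBE rB] := bB.
have sDE D : B :\: D \subset ground K by rewrite (subset_trans _ sBE) ?subsetDl.
have inj : {in C &, injective (fun c => cl K (B :\ c))}.
  move=> c d cC dC /= e; apply/eqP; apply: contraT => cd.
  have := notin_cl_basis bB (subsetP sCB _ cC); rewrite e => /negP[].
  by apply: (subsetP (sub_cl (sDE _))); rewrite !inE cd (subsetP sCB).
apply: closedN => //.
- apply/subsetP => _ /imsetP[c cC ->].
  exact/coordinate_hyperplane/(subsetP sCB).
- move=> _ /imsetP[c cC ->]; have cB := subsetP sCB _ cC.
  apply/negP => /subsetP/(_ c); rewrite (negPf (notin_cl_basis bB cB)).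
  suff -> : c \in meet K ([set cl K (B :\ d) | d in C] :\ cl K (B :\ c)).
    by move=> /(_ isT).
  rewrite inE (subsetP sBE) //=; apply/bigcapP => H'.
  rewrite inE => /andP[ne /imsetP[d dC eH']]; rewrite eH' in ne *.
  apply: (subsetP (sub_cl (sDE _))); rewrite !inE cB andbT.
  by apply: contraNneq ne => ->; rewrite set11.
- rewrite (meet_coordinate_hyperplanes bB sCB) rank_cl // card_in_imset //.
  rewrite (rank_indepE (indepS (subsetDl B C) iB)) /rk -rB.
  by have := cardsDS sCB; have := subset_leq_card sCB; lia.
- rewrite (meet_coordinate_hyperplanes bB sCB).
  by apply: cl_sub_flat => //; have /hyperplaneP[] := hH.
Qed.

(** The coordinate hyperplanes over [X] span all the hyperplanes over [X], so
    bounds on [rank N (hyperplanes_over X)] reduce to finding a set [Z] that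
    contains the coordinate ones. *)
Lemma hyperplanes_over_span B J X Z :
    X \subset ground K -> basis_of K X J -> basis_of K (ground K) B ->
    J \subset B -> (forall c, c \in B :\: J -> cl K (B :\ c) \in Z) ->
  rank N (hyperplanes_over X) <= rank N (Z :&: ground N).
Proof.
move=> sXE bJ bB sJB ZB; apply: rank_sub_cl; first exact: subsetIr.
apply/subsetP => H; rewrite inE => /andP[hH sXH].
have sJX : J \subset X by case/basisP: bJ.
have : H \in cl N [set cl K (B :\ c) | c in B :\: J].
  apply: coordinate_hyperplanes_span => //; first exact: subsetDl.
  by rewrite setDDr setDv set0U (setIidPr sJB) (subset_trans sJX).
apply: subsetP; apply: clS; apply/subsetP => _ /imsetP[c cBJ ->].
rewrite inE ZB //= groundN; apply: coordinate_hyperplane => //.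
by move: cBJ; rewrite inE => /andP[].
Qed.

Definition rank_sum X : nat := rank K X + rank N (hyperplanes_over X).

Definition projection_rank X : nat := rank_sum X - rk N.

Lemma rank_sum_cl x X : x \in cl K X -> rank_sum (x |: X) = rank_sum X.
Proof.
by move=> xX; rewrite /rank_sum hyperplanes_over_cl //; case/clP: xX => _ ->.
Qed.

(** For [x] outside the closure, [rank K] gains 1, so it suffices that the
    hyperplanes over [X] are spanned by those over [x |: X] and one more: the
    coordinate hyperplane that omits [x], in a basis through [x]. *)
Lemma rank_sum_setU1 x X :
  X \subset ground K -> x \in ground K -> rank_sum X <= rank_sum (x |: X).
Proof.
move=> sXE xE.
have [xX|xX] := boolP (x \in cl K X); first by rewrite rank_sum_cl.
have [J bJ] := basis_exists K X.
have bxJ := basis_setU1 sXE bJ xE xX.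
have sxXE : x |: X \subset ground K by rewrite subUset sub1set xE.
have /basisP[ixJ sxJ _] := bxJ.
have [B bB sxJB] := basis_extend ixJ (subset_trans sxJ sxXE).
have sJB := subset_trans (subsetUr _ _) sxJB.
pose Z := cl K (B :\ x) |: hyperplanes_over (x |: X).
have spanX : rank N (hyperplanes_over X) <= rank N (Z :&: ground N).
  apply: (hyperplanes_over_span sXE bJ bB sJB) => // c.
  rewrite !inE => /andP[cJ cB].
  have [->|cx] := eqVneq c x; first by rewrite eqxx.
  have := coordinate_hyperplane bB cB; rewrite inE => ->.
  rewrite (sub_coordinate_hyperplane sxXE bxJ) ?orbT //.
  by rewrite !inE negb_or cx.
rewrite rankIground in spanX.
rewrite /rank_sum (rank_notin_cl xE xX) addSnnS leq_add2l.
exact: leq_trans spanX (rankU1 _ _ _).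
Qed.

(** In a basis through a basis of [X], [x] and [y], no coordinate hyperplane
    omits both [x] and [y], so the hyperplanes over [x |: X] and those over
    [y |: X] together span the ones over [X]. *)
Lemma rank_sum_submod x y X : X \subset ground K ->
    x \in ground K -> y \in ground K ->
    x \notin cl K X -> y \notin cl K (x |: X) ->
  rank_sum X + rank_sum (x |: (y |: X))
    <= rank_sum (x |: X) + rank_sum (y |: X).
Proof.
move=> sXE xE yE xX yxX.
have sxXE : x |: X \subset ground K by rewrite subUset sub1set xE.
have syXE : y |: X \subset ground K by rewrite subUset sub1set yE.
have yX : y \notin cl K X by apply: contra yxX; apply/subsetP/clS/subsetUr.
have [J bJ] := basis_exists K X.
have bxJ := basis_setU1 sXE bJ xE xX.
have byJ := basis_setU1 sXE bJ yE yX.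
have byxJ := basis_setU1 sxXE bxJ yE yxX.
have yx : y != x.
  by apply: contraNneq yxX => ->; rewrite (subsetP (sub_cl sxXE)) ?setU11.
have syxXE : y |: (x |: X) \subset ground K by rewrite subUset sub1set yE.
have /basisP[iJ' sJ' _] := byxJ.
have [B bB sB] := basis_extend iJ' (subset_trans sJ' syxXE).
have sJB : J \subset B.
  by rewrite (subset_trans _ sB) // setUA subsetUr.
pose Z := hyperplanes_over (x |: X) :|: hyperplanes_over (y |: X).
have spanX : rank N (hyperplanes_over X) <= rank N (Z :&: ground N).
  apply: (hyperplanes_over_span sXE bJ bB sJB) => // c.
  rewrite inE => /andP[cJ cB].
  have hc := coordinate_hyperplane bB cB.
  rewrite !inE; move: hc; rewrite inE => ->/=.
  have [cx|cx] := eqVneq c x.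
    rewrite (sub_coordinate_hyperplane syXE byJ) ?orbT //.
      by rewrite (subset_trans _ sB) // setUS // subsetUr.
    by rewrite !inE negb_or cx eq_sym yx -cx.
  rewrite (sub_coordinate_hyperplane sxXE bxJ) //.
    by rewrite (subset_trans _ sB) // subsetUr.
  by rewrite !inE negb_or cx.
rewrite rankIground in spanX.
have := rank_submod N (hyperplanes_over (x |: X)) (hyperplanes_over (y |: X)).
have -> : hyperplanes_over (x |: X) :&: hyperplanes_over (y |: X)
          = hyperplanes_over (x |: (y |: X)).
  by apply/setP => H; rewrite !inE !subUset; do !case: (_ \subset _);
    rewrite ?andbF ?andbT ?andbb.
rewrite -/Z /rank_sum (setUCA [set x]) (rank_notin_cl yE yxX).
rewrite (rank_notin_cl xE xX) (rank_notin_cl yE yX); move: spanX; clear; lia.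
Qed.

Lemma rank_sum_mono X Y :
  X \subset Y -> Y \subset ground K -> rank_sum X <= rank_sum Y.
Proof.
apply: (setU1_ind (P := fun Y => rank_sum X <= rank_sum Y)) => //.
move=> C x _ sCE xE _.
by move/leq_trans; apply; apply: rank_sum_setU1.
Qed.

Lemma rank_sum_ge X : X \subset ground K -> rk N <= rank_sum X.
Proof.
move/(rank_sum_mono (sub0set X)); apply: leq_trans.
rewrite /rank_sum rank_set0 /rk groundN; apply: rankS.
by apply/subsetP => H hH; rewrite inE hH sub0set.
Qed.

(** If [x] is in the closure of [X], or [y] in that of [x |: X], the added point
    changes nothing; otherwise submodularity bounds the left side by
    [rank_sum X] and monotonicity gives equality. *)
Lemma rank_sum_local x y X :
    X \subset ground K -> x \in ground K -> y \in ground K ->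
    rank_sum (x |: X) = rank_sum X -> rank_sum (y |: X) = rank_sum X ->
  rank_sum (x |: (y |: X)) = rank_sum X.
Proof.
move=> sXE xE yE gx gy.
have sU z : z \in ground K -> z |: X \subset ground K.
  by move=> zE; rewrite subUset sub1set zE.
have [xX|xX] := boolP (x \in cl K X).
  by rewrite rank_sum_cl //; apply: subsetP xX; apply/clS/subsetUr.
have [yX|yX] := boolP (y \in cl K (x |: X)).
  by rewrite setUCA rank_sum_cl.
have := rank_sum_submod sXE xE yE xX yX; rewrite gx gy.
have := rank_sum_setU1 (sU y yE) xE; rewrite gy; lia.
Qed.

Lemma projection_rank_function : rank_function (ground K) projection_rank.
Proof.
have gE X : X \subset ground K -> projection_rank X + rk N = rank_sum X.
  by move=> sXE; rewrite subnK // rank_sum_ge.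
have sU z X : z \in ground K -> X \subset ground K -> z |: X \subset ground K.
  by move=> zE sXE; rewrite subUset sub1set zE.
split.
- rewrite /projection_rank /rank_sum rank_set0 add0n.
  apply/eqP; rewrite subn_eq0.
  by rewrite /rk groundN rankS //; apply/subsetP => H; rewrite inE => /andP[].
- move=> X x sXE xE.
  have := gE X sXE; have := gE _ (sU _ _ xE sXE); have := rank_sum_setU1 sXE xE.
  have := rankU1 K X x.
  have := rankS N (hyperplanes_overS (subsetUr [set x] X)).
  by rewrite /rank_sum; lia.
- move=> X x y sXE xE yE fx fy.
  have := gE X sXE; have := gE _ (sU _ _ xE sXE); have := gE _ (sU _ _ yE sXE).
  have := gE _ (sU _ _ xE (sU _ _ yE sXE)); rewrite fx fy => e1 e2 e3 e4.
  have := rank_sum_local sXE xE yE.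
  by rewrite -e3 -e2 -e4 => /(_ erefl erefl); lia.
Qed.

End HyperplaneMatroid.

Theorem theorem1p8 (T : finType) (K : matroid T) (N : matroid {set T})
    (groundN : ground N = hyperplanes K)
    (closedN : forall Hs : {set {set T}},
       Hs \subset hyperplanes K ->
       (forall H : {set T}, H \in Hs -> ~~ (meet K (Hs :\ H) \subset H)) ->
       (rank K (meet K Hs))%:Z = (rk K)%:Z - #|Hs|%:Z ->
       forall H' : {set T}, H' \in hyperplanes K -> meet K Hs \subset H' ->
         H' \in cl N Hs) :
  exists KN : matroid T,
    [/\ ground KN = ground K,
        forall X : {set T}, X \subset ground K ->
          (rank KN X)%:Z = (rank K X)%:Z - (rk N)%:Z
            + (rank N [set H in hyperplanes K | X \subset H])%:Z
      & rank_projection (rk N) KN K].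
Proof.
have closedN' (Hs : {set {set T}}) : Hs \subset hyperplanes K ->
    (forall H : {set T}, H \in Hs -> ~~ (meet K (Hs :\ H) \subset H)) ->
    (rank K (meet K Hs) + #|Hs|)%N = rk K ->
    forall H : {set T}, H \in hyperplanes K -> meet K Hs \subset H ->
      H \in cl N Hs.
  by move=> sHs irr rHs; apply: closedN => //; lia.
have fR := projection_rank_function groundN closedN'.
pose KN := rank_matroid fR.
have rankKN (X : {set T}) : X \subset ground K ->
    (rank KN X + rk N = rank K X + rank N (hyperplanes_over K X))%N.
  by move=> sXE; rewrite rank_matroidE // subnK // rank_sum_ge.
have overE : hyperplanes_over K (ground K) = set0.
  apply/setP => H; rewrite !inE; apply/negP => /andP[/andP[_ /eqP rH] sEH].
  by have := rankS K sEH; rewrite -/(rk K) -rH ltnn.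
exists KN; split=> // [X sXE|].
  by have := rankKN X sXE; rewrite /hyperplanes_over; lia.
split.
  apply: quotient_projection => // X Y sXY sYE.
  have := rankKN X (subset_trans sXY sYE); have := rankKN Y sYE.
  have := rankS N (hyperplanes_overS K sXY); lia.
have := rankKN _ (subxx _); rewrite overE rank_set0 /rk /=; lia.
Qed.
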